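(* For every integer $N\ge 2$ there exist displacements and an initial condition $I$ such that, in the multiparticle model $(T,I,N)$, some particle has a periodic trajectory. Moreover, these periodic trajectories can have arbitrarily large size and period: for every $N\ge 2$ and every $M>0$ there exist displacements and an initial condition $I$ such that some particle in $(T,I,N)$ has a periodic trajectory whose size and period are both at least $M$.
   Context: **Lattice.** $T=(\mathbb{T},\mathbb{B})$ is the triangular lattice with sites $\mathbb{T}=\{a(1,0)+b(1/2,\sqrt3/2):a,b\in\mathbb{Z}\}\subset\mathbb{R}^2$; its bonds $\mathbb{B}$ are the unit segments joining sites at distance $1$ (each site has six neighbors). **Multiparticle model $(T,I,N)$, unit speed.** There are $N\ge1$ particles $p_1,\dots,p_N$ moving along bonds with unit speed. Particle $p_i$ has position $\mathbf{r}_i(\cdot)\in\mathbb{R}^2$, velocity $\mathbf{v}_i(\cdot)\in\mathbb{R}^2$ (a unit vector in one of the six bond directions), and displacement $\triangle t_i$, where $0=\triangle t_1<\triangle t_2<\dots<\triangle t_N<1$; set $\triangle t_{N+1}=1$, so that time $t+\triangle t_{N+1}$ is time $(t+1)+\triangle t_1$. Particle $p_i$ is at a lattice site exactly at the times $t+\triangle t_i$, $t$ an integer. Every site $\mathbf{h}\in\mathbb{T}$ carries a scatterer with orientation $C(s,\mathbf{h})\in\{-1,1\}$ at time $s$ ($-1$: left rotator; $1$: right rotator). An initial condition is $I=(\bar{\mathbf{r}},\bar{\mathbf{v}},C)$, with $\bar{\mathbf r}=(\mathbf r_1,\dots,\mathbf r_N)$ and $\bar{\mathbf v}=(\mathbf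 v_1,\dots,\mathbf v_N)$ the positions and velocities at time $0$ (with $\mathbf{r}_i+\triangle t_i\mathbf{v}_i\in\mathbb{T}$) and $C=C(0,\cdot)$ the configuration at time $0$. Here $\mathbf{v}_i(t+\triangle t_i)$ and $C(t+\triangle t_i,\cdot)$ denote values just before $p_i$ is scattered at that time. For $t\in\mathbb{N}=\{0,1,2,\dots\}$, $1\le i\le N$, $1\le j\le N$ the dynamics are: - $\mathbf{v}_i(t+\triangle t_{j+1})=R[C(t+\triangle t_i,\mathbf{r}_i(t+\triangle t_i))]\,\mathbf{v}_i(t+\triangle t_i)$ if $j=i$, and $=\mathbf{v}_i(t+\triangle t_j)$ otherwise; - $\mathbf{r}_i(t+\triangle t_{j+1})=\mathbf{r}_i(t+\triangle t_j)+(\triangle t_{j+1}-\triangle t_j)\,\mathbf{v}_i(t+\triangle t_{j+1})$; - $C(t+\triangle t_{j+1},\mathbf{h})=-C(t+\triangle t_j,\mathbf{h})$ if $\mathbf{h}=\mathbf{r}_j(t+\triangle t_j)$, and $=C(t+\triangle t_j,\mathbf{h})$ otherwise; where $R[z]=\begin{pmatrix}\cos(2\pi z/3)&\sin(2\pi z/3)\\-\sin(2\pi z/3)&\cos(2\pi z/3)\end{pmatrix}$ for $z\in\{-1,1\}$. Thus a particle arriving at a left (right) rotator has its velocity rotated by $2\pi/3$ to its left (right), and the rotator then flips orientation; particles do not otherwise interact. Positions at all real times $t\ge 0$ are given by linear motion between these times. **Periodic trajectory, period, size.** The trajectory of $p_i$ is periodic if there is $\tau_i\in(0,\infty)$ with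 $\mathbf{r}_i(t+\tau_i)=\mathbf{r}_i(t)$ for all $t\ge0$; the smallest such $\tau_i$ is its period. The size of a periodic trajectory is the number of distinct lattice sites the particle visits in one period. *)

(* Defs.v *)
From Stdlib Require Import Reals ZArith List.
Open Scope R_scope.

Definition vec : Type := (R * R)%type.

Definition vadd (x y : vec) : vec := (fst x + fst y, snd x + snd y).

Definition vscal (a : R) (x : vec) : vec := (a * fst x, a * snd x).

(* The set of sites of the triangular lattice. *)
Definition site (h : vec) : Prop :=
  exists a b : Z,
    h = vadd (vscal (IZR a) (1, 0)) (vscal (IZR b) (1 / 2, sqrt 3 / 2)).

Definition bond (h k : vec) : Prop :=
  site h /\ site k /\ dist_euc (fst h) (snd h) (fst k) (snd k) = 1.

Definition bond_direction (v : vec) : Prop :=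
  exists h k : vec, bond h k /\ k = vadd h v.

(* The matrix with rows (cos a, sin a) and (- sin a, cos a), a = 2 pi z / 3:
   a clockwise (right) rotation for z = 1, a left one for z = -1. *)
Definition rot (z : Z) (v : vec) : vec :=
  let a := 2 * PI * IZR z / 3 in
  (cos a * fst v + sin a * snd v, - sin a * fst v + cos a * snd v).

(* Particles are numbered 1, ..., N; values of the families below at other
   indices are irrelevant, except for the convention dt (N + 1) = 1. *)
Record displacements (N : nat) (dt : nat -> R) : Prop := {
  dt_first : dt 1%nat = 0;
  dt_incr  : forall i : nat, (1 <= i <= N)%nat -> dt i < dt (i + 1)%nat;
  dt_last  : dt (N + 1)%nat = 1
}.

(* Orientations are -1 (left) and 1 (right); a configuration is a function on
   the plane of which only the values at sites are meaningful. *)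
Record initial_data : Type := {
  pos0  : nat -> vec;
  vel0  : nat -> vec;
  conf0 : vec -> Z
}.

Record initial_condition (N : nat) (dt : nat -> R) (I : initial_data)
    : Prop := {
  vel0_bond  : forall i : nat, (1 <= i <= N)%nat -> bond_direction (vel0 I i);
  pos0_site  : forall i : nat, (1 <= i <= N)%nat ->
    site (vadd (pos0 I i) (vscal (dt i) (vel0 I i)));
  conf0_sign : forall h : vec, site h ->
    conf0 I h = (-1)%Z \/ conf0 I h = 1%Z
}.

(* [evolution N dt I r v C]: r, v, C are the positions, velocities and
   configurations, as functions of real time, of the model started from I.
   At the time t + dt j, v and C hold the values just before particle j is
   scattered; hence v i (t + dt (j + 1)) is the velocity of particle i
   throughout the time interval (t + dt j, t + dt (j + 1)].  Only the values
   of v and C at the times t + dt j are meaningful, whereas r is determined at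
   all times s >= 0. *)
Record evolution (N : nat) (dt : nat -> R) (I : initial_data)
    (r v : nat -> R -> vec) (C : R -> vec -> Z) : Prop := {
  pos_init : forall i : nat, (1 <= i <= N)%nat -> r i 0 = pos0 I i;
  vel_init : forall i : nat, (1 <= i <= N)%nat -> v i 0 = vel0 I i;
  conf_init : forall h : vec, site h -> C 0 h = conf0 I h;

  vel_scattered : forall t i : nat, (1 <= i <= N)%nat ->
    v i (INR t + dt (i + 1)%nat)
    = rot (C (INR t + dt i) (r i (INR t + dt i))) (v i (INR t + dt i));
  vel_free : forall t i j : nat,
    (1 <= i <= N)%nat -> (1 <= j <= N)%nat -> j <> i ->
    v i (INR t + dt (j + 1)%nat) = v i (INR t + dt j);

  (* For s = t + dt (j + 1) this is the recursion for the positions; for the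
     intermediate s it is the linear interpolation. *)
  pos_linear : forall (t i j : nat) (s : R),
    (1 <= i <= N)%nat -> (1 <= j <= N)%nat ->
    INR t + dt j <= s <= INR t + dt (j + 1)%nat ->
    r i s = vadd (r i (INR t + dt j))
                 (vscal (s - (INR t + dt j)) (v i (INR t + dt (j + 1)%nat)));

  conf_flip : forall (t j : nat) (h : vec), (1 <= j <= N)%nat -> site h ->
    h = r j (INR t + dt j) ->
    C (INR t + dt (j + 1)%nat) h = Z.opp (C (INR t + dt j) h);
  conf_same : forall (t j : nat) (h : vec), (1 <= j <= N)%nat -> site h ->
    h <> r j (INR t + dt j) ->
    C (INR t + dt (j + 1)%nat) h = C (INR t + dt j) h
}.

Definition recurs_after (x : R -> vec) (tau : R) : Prop :=
  0 < tau /\ forall t : R, 0 <= t -> x (t + tau) = x t.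

Definition periodic (x : R -> vec) : Prop := exists tau : R, recurs_after x tau.

Definition is_period (x : R -> vec) (tau : R) : Prop :=
  recurs_after x tau /\
  forall tau' : R, recurs_after x tau' -> tau <= tau'.

(* Exactly n distinct sites are visited by x during one period. *)
Definition has_size (x : R -> vec) (n : nat) : Prop :=
  exists tau : R, is_period x tau /\
  exists l : list vec, NoDup l /\ length l = n /\
    forall h : vec,
      In h l <-> site h /\ exists s : R, 0 <= s < tau /\ x s = h.

(* Main.v *)
Require Import Defs.
From Stdlib Require Import Reals ZArith List Lra Lia.
From Stdlib Require Import Classical Wf_nat FinFun FunctionalExtensionality.
Import ListNotations.
Open Scope R_scope.

(** Let two particles be about to scatter, and count time in single scatterings.
    Reversing both velocities reverses the dynamics, with the roles of the two
    particles exchanged.  A state in which the particles run through the same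
    bond in opposite directions is fixed by this reversal, so that an orbit with
    two such head-on states is periodic: after the second one each particle
    retraces the path of the other.  Arbitrarily long orbit segments between two
    head-on states are obtained from a glider, a pair of particles which in
    suitable fresh surroundings moves by (2, 2) (in the basis of the lattice)
    every 27 units of time: the pair leaves a head-on state, glides for any
    number of periods, and is then led into another head-on state.  A word of
    turns is realized by some configuration as soon as successive turns at the
    same site alternate, and for the glider this is a finite computation, since
    it meets only four sites of its past.  The other particles run along
    zigzags, away from the pair and from each other. *)

(** * Coordinates on the triangular lattice *)

(** Coordinates in the lattice basis are allowed to be real, so that points inside a bond are
    covered too. *)
Definition embR (x y : R) : vec := (x + y / 2, y * (sqrt 3 / 2)).

Definition emb (p : Z * Z) : vec := embR (IZR (fst p)) (IZR (snd p)).

Definition padd (p q : Z * Z) : Z * Z := (fst p + fst q, snd p + snd q)%Z.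

Definition popp (p : Z * Z) : Z * Z := (- fst p, - snd p)%Z.

(** A third of a turn in the lattice basis, clockwise for [z = 1] and counterclockwise otherwise. *)
Definition rotZ (z : Z) (p : Z * Z) : Z * Z :=
  if Z.eqb z 1 then (snd p, - fst p - snd p)%Z else (- fst p - snd p, fst p)%Z.

Definition coords (h : vec) : Z * Z :=
  let b := Int_part (snd h / (sqrt 3 / 2)) in
  (Int_part (fst h - IZR b / 2), b).

(** The quadratic form is the squared Euclidean length in the lattice basis; its solutions are the
    six bond directions. *)
Definition unit_direction (p : Z * Z) : Prop :=
  (fst p * fst p + fst p * snd p + snd p * snd p = 1)%Z.

Lemma Zpair_eq_dec (p q : Z * Z) : {p = q} + {p <> q}.
Proof. decide equality; apply Z.eq_dec. Defined.

Arguments Zpair_eq_dec : simpl never.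

Lemma half_sqrt3_pos : 0 < sqrt 3 / 2.
Proof. assert (0 < sqrt 3) by (apply sqrt_lt_R0; lra). lra. Qed.

Lemma embR_inj (x y x' y' : R) : embR x y = embR x' y' -> x = x' /\ y = y'.
Proof.
  unfold embR; intros E; injection E as E1 E2.
  assert (y = y') by (apply Rmult_eq_reg_r with (sqrt 3 / 2); [exact E2|];
    pose proof half_sqrt3_pos; lra).
  lra.
Qed.

Lemma emb_inj (p q : Z * Z) : emb p = emb q -> p = q.
Proof.
  destruct p, q; intros E; apply embR_inj in E; simpl in E.
  destruct E as [E1 E2]; apply eq_IZR in E1, E2; congruence.
Qed.

Lemma emb_padd (p q : Z * Z) : emb (padd p q) = vadd (emb p) (emb q).
Proof.
  unfold emb, padd, vadd, embR; simpl; rewrite !plus_IZR; f_equal; field.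
Qed.

Lemma Int_part_IZR (z : Z) : Int_part (IZR z) = z.
Proof. symmetry; apply Int_part_spec; lra. Qed.

Lemma coords_emb (p : Z * Z) : coords (emb p) = p.
Proof.
  destruct p as [x y]; unfold coords, emb, embR; simpl.
  pose proof half_sqrt3_pos.
  replace (IZR y * (sqrt 3 / 2) / (sqrt 3 / 2)) with (IZR y) by (field; lra).
  rewrite Int_part_IZR.
  replace (IZR x + IZR y / 2 - IZR y / 2) with (IZR x) by ring.
  now rewrite Int_part_IZR.
Qed.

Lemma site_iff_emb (h : vec) : site h <-> exists p, h = emb p.
Proof.
  split.
  - intros (a & b & ->); exists (a, b).
    unfold emb, embR, vadd, vscal; simpl; f_equal; field.
  - intros [[a b] ->]; exists a, b.
    unfold emb, embR, vadd, vscal; simpl; f_equal; field.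
Qed.

Lemma rot_emb (z : Z) (p : Z * Z) :
  z = (-1)%Z \/ z = 1%Z -> rot z (emb p) = emb (rotZ z p).
Proof.
  assert (S : sqrt 3 * sqrt 3 = 3) by (apply sqrt_sqrt; lra).
  assert (HC : cos (2 * PI / 3) = - (1 / 2)).
  { replace (2 * PI / 3) with (2 * (PI / 3)) by field.
    rewrite cos_2a_cos, cos_PI3; field. }
  assert (HS : sin (2 * PI / 3) = sqrt 3 / 2).
  { replace (2 * PI / 3) with (2 * (PI / 3)) by field.
    rewrite sin_2a, cos_PI3, sin_PI3; field. }
  destruct p as [x y].
  assert (Sy : sqrt 3 * sqrt 3 * IZR y = 3 * IZR y) by (rewrite S; ring).
  intros [-> | ->]; unfold rot, rotZ, emb, embR; simpl.
  - replace (2 * PI * -1 / 3) with (- (2 * PI / 3)) by field.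
    rewrite cos_neg, sin_neg, HC, HS, minus_IZR, opp_IZR; f_equal; nra.
  - replace (2 * PI * 1 / 3) with (2 * PI / 3) by field.
    rewrite HC, HS, minus_IZR, opp_IZR; f_equal; nra.
Qed.

Lemma bond_direction_emb (p : Z * Z) :
  unit_direction p -> bond_direction (emb p).
Proof.
  intros U; exists (emb (0, 0)%Z), (emb p); split; [split; [|split]|].
  - apply site_iff_emb; eauto.
  - apply site_iff_emb; eauto.
  - unfold dist_euc, emb, embR, Rsqr; simpl.
    apply (f_equal IZR) in U; rewrite !plus_IZR, !mult_IZR in U.
    assert (S : sqrt 3 * sqrt 3 = 3) by (apply sqrt_sqrt; lra).
    rewrite <- sqrt_1; f_equal; nra.
  - destruct p; unfold emb, embR, vadd; simpl; f_equal; field.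
Qed.

(** * Motion at unit speed along a lattice path *)

(** [H z] is the site reached at time [z + d], and [D z] the heading from there. Negative indices
    occur: at time 0 a particle with [0 < d < 1] is on the bond of index -1. *)
Definition traj (H D : Z -> Z * Z) (d s : R) : vec :=
  let z := Int_part (s - d) in
  vadd (emb (H z)) (vscal (s - d - IZR z) (emb (D z))).

(* [- up (d - s)] is the largest integer strictly below [s - d]: at the site
   times this is the velocity just before the scattering. *)
Definition velo (D : Z -> Z * Z) (d s : R) : vec := emb (D (- up (d - s))%Z).

Lemma traj_linear (H D : Z -> Z * Z) (d s : R) (m : Z) :
  (forall t, H (t + 1)%Z = padd (H t) (D t)) ->
  IZR m <= s - d <= IZR m + 1 ->
  traj H D d s = vadd (emb (H m)) (vscal (s - d - IZR m) (emb (D m))).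
Proof.
  intros HD [L U]; unfold traj; destruct (Rlt_dec (s - d) (IZR m + 1)) as [W|W].
  - replace (Int_part (s - d)) with m; [reflexivity|].
    apply Int_part_spec; lra.
  - assert (E : s - d = IZR (m + 1)) by (rewrite plus_IZR; lra).
    rewrite E, Int_part_IZR, HD, emb_padd, plus_IZR.
    unfold vadd, vscal; simpl; f_equal; ring.
Qed.

Lemma velo_before (D : Z -> Z * Z) (d s : R) (m : Z) :
  IZR m < s - d <= IZR m + 1 -> velo D d s = emb (D m).
Proof.
  intros B; unfold velo; do 2 f_equal.
  rewrite <- (tech_up (d - s) (- m)%Z); rewrite ?opp_IZR; lia || lra.
Qed.

(** * Configurations flipped along prescribed paths *)

(** With equal spacing, [N] times the time of a scattering is the number of scatterings before
    it. *)
Definition dtN (N i : nat) : R := (INR i - 1) / INR N.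

(** The state after [k] scatterings if the particles follow [H]. Counted from 0, scattering [k] is
    that of particle [k mod N + 1] at its site of index [k / N]. *)
Fixpoint conf (N : nat) (H : nat -> Z -> Z * Z) (c0 : Z * Z -> Z) (k : nat)
    (p : Z * Z) : Z :=
  match k with
  | O => c0 p
  | S k => if Zpair_eq_dec p (H (k mod N + 1)%nat (Z.of_nat (k / N)))
           then Z.opp (conf N H c0 k p) else conf N H c0 k p
  end.

Definition tick (N : nat) (s : R) : nat := Z.to_nat (Int_part (s * INR N)).

Definition confR (N : nat) (H : nat -> Z -> Z * Z) (c0 : Z * Z -> Z) (s : R)
    (h : vec) : Z := conf N H c0 (tick N s) (coords h).

Definition start (N : nat) (H D : nat -> Z -> Z * Z) (c0 : Z * Z -> Z)
  : initial_data :=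
  {| pos0 := fun i => traj (H i) (D i) (dtN N i) 0;
     vel0 := fun i => velo (D i) (dtN N i) 0;
     conf0 := fun h => c0 (coords h) |}.

Lemma displacements_dtN (N : nat) : (1 <= N)%nat -> displacements N (dtN N).
Proof.
  intros HN; assert (0 < INR N) by (apply lt_0_INR; lia).
  split; unfold dtN; intros; rewrite ?plus_INR; simpl; try (field; lra).
  apply Rmult_lt_compat_r; [apply Rinv_0_lt_compat|]; lra.
Qed.

Lemma dtN_bounds (N i : nat) :
  (1 <= i <= N)%nat -> 0 <= dtN N i < 1.
Proof.
  intros Hi; assert (0 < INR N) by (apply lt_0_INR; lia).
  assert (1 <= INR i) by (apply (le_INR 1); lia).
  assert (INR i <= INR N) by (apply le_INR; lia).
  unfold dtN; split.
  - apply Rmult_le_pos; [lra | left; now apply Rinv_0_lt_compat].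
  - apply Rmult_lt_reg_r with (INR N); [lra|].
    unfold Rdiv; rewrite Rmult_assoc, Rinv_l; lra.
Qed.

Lemma dtN_le (N i j : nat) : (1 <= N)%nat -> (i <= j)%nat -> dtN N i <= dtN N j.
Proof.
  intros HN Hij; assert (0 < INR N) by (apply lt_0_INR; lia).
  apply le_INR in Hij; unfold dtN.
  apply Rmult_le_compat_r; [left; now apply Rinv_0_lt_compat | lra].
Qed.

Lemma dtN_lt (N i j : nat) : (1 <= N)%nat -> (i < j)%nat -> dtN N i < dtN N j.
Proof.
  intros HN Hij; assert (0 < INR N) by (apply lt_0_INR; lia).
  apply lt_INR in Hij; unfold dtN.
  apply Rmult_lt_compat_r; [now apply Rinv_0_lt_compat | lra].
Qed.

Lemma tick_dtN (N t j : nat) :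
  (1 <= N)%nat -> tick N (INR t + dtN N (j + 1)) = (t * N + j)%nat.
Proof.
  intros HN; assert (0 < INR N) by (apply lt_0_INR; lia).
  unfold tick, dtN.
  replace ((INR t + (INR (j + 1) - 1) / INR N) * INR N)
    with (IZR (Z.of_nat (t * N + j))).
  - rewrite Int_part_IZR; lia.
  - rewrite <- INR_IZR_INZ, !plus_INR, mult_INR; simpl; field; lra.
Qed.

Lemma conf_step (N : nat) H c0 (t j : nat) (p : Z * Z) :
  (j < N)%nat ->
  conf N H c0 (t * N + j + 1) p
  = if Zpair_eq_dec p (H (j + 1)%nat (Z.of_nat t))
    then Z.opp (conf N H c0 (t * N + j) p) else conf N H c0 (t * N + j) p.
Proof.
  intros Hj; replace (t * N + j + 1)%nat with (S (t * N + j)) by lia; simpl.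
  replace ((t * N + j) mod N)%nat with j; [replace ((t * N + j) / N)%nat with t|].
  - reflexivity.
  - apply Nat.div_unique with j; lia.
  - apply Nat.mod_unique with t; lia.
Qed.

Lemma conf_sign (N : nat) H c0 (k : nat) (p : Z * Z) :
  (forall p, c0 p = (-1)%Z \/ c0 p = 1%Z) ->
  conf N H c0 k p = (-1)%Z \/ conf N H c0 k p = 1%Z.
Proof.
  intros Hc; induction k as [|k IH]; simpl; [apply Hc|].
  destruct (Zpair_eq_dec _ _); lia.
Qed.

Lemma traj_at_site (N : nat) (H D : Z -> Z * Z) (t i : nat) :
  traj H D (dtN N i) (INR t + dtN N i) = emb (H (Z.of_nat t)).
Proof.
  unfold traj; replace (INR t + dtN N i - dtN N i) with (IZR (Z.of_nat t))
    by (rewrite <- INR_IZR_INZ; ring).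
  rewrite Int_part_IZR; unfold vadd, vscal, emb, embR; simpl; f_equal; ring.
Qed.

Lemma start_initial_condition (N : nat) (H D : nat -> Z -> Z * Z) c0 :
  (forall p, c0 p = (-1)%Z \/ c0 p = 1%Z) ->
  (forall i t, (1 <= i <= N)%nat -> H i (t + 1)%Z = padd (H i t) (D i t)) ->
  (forall i t, (1 <= i <= N)%nat -> unit_direction (D i t)) ->
  initial_condition N (dtN N) (start N H D c0).
Proof.
  intros Hc HH HU; split; simpl.
  - intros i Hi; apply bond_direction_emb, HU, Hi.
  - intros i Hi; pose proof (dtN_bounds N i Hi).
    rewrite (velo_before _ _ _ (-1)) by lra.
    rewrite (traj_linear _ _ _ _ (-1)) by (auto || lra).
    apply site_iff_emb; exists (H i 0%Z).
    rewrite (HH i (-1)%Z Hi : H i 0%Z = _), emb_padd.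
    unfold vadd, vscal; simpl; f_equal; ring.
  - intros h _; apply Hc.
Qed.

(** Paths given in advance solve the dynamics as soon as each turn agrees with the scatterer that
    these same paths have flipped. Real time is thereby reduced to counting scatterings. *)
Lemma lattice_evolution (N : nat) (H D : nat -> Z -> Z * Z) c0 :
  (1 <= N)%nat ->
  (forall p, c0 p = (-1)%Z \/ c0 p = 1%Z) ->
  (forall i t, (1 <= i <= N)%nat -> H i (t + 1)%Z = padd (H i t) (D i t)) ->
  (forall t j : nat, (j < N)%nat ->
     D (j + 1)%nat (Z.of_nat t)
     = rotZ (conf N H c0 (t * N + j) (H (j + 1)%nat (Z.of_nat t)))
            (D (j + 1)%nat (Z.of_nat t - 1)%Z)) ->
  evolution N (dtN N) (start N H D c0)
    (fun i => traj (H i) (D i) (dtN N i)) (fun i => velo (D i) (dtN N i))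
    (confR N H c0).
Proof.
  intros HN Hc HH HD.
  destruct (displacements_dtN N HN) as [D1 _ DN].
  (* The interval between two consecutive scatterings lies in one step of particle [i], of index
     [t - 1] if [j < i] and [t] otherwise. Its left end is strictly after the start of that step
     unless [j = i], when particle [i] itself is scattered there. *)
  assert (Hlast : forall t i j, (1 <= i <= N)%nat -> (1 <= j <= N)%nat ->
     exists m, IZR m <= INR t + dtN N j - dtN N i /\
       IZR m < INR t + dtN N (j + 1) - dtN N i <= IZR m + 1 /\
       (j <> i -> IZR m < INR t + dtN N j - dtN N i)).
  { intros t i j Hi Hj; pose proof (dtN_bounds N i Hi).
    destruct (Nat.lt_ge_cases j i) as [Hji|Hij].
    - exists (Z.of_nat t - 1)%Z; rewrite minus_IZR, <- INR_IZR_INZ.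
      pose proof (dtN_bounds N j Hj).
      pose proof (dtN_lt N j (j + 1) HN ltac:(lia)).
      pose proof (dtN_le N (j + 1) i HN ltac:(lia)); lra.
    - exists (Z.of_nat t); rewrite <- INR_IZR_INZ.
      pose proof (dtN_lt N j (j + 1) HN ltac:(lia)).
      pose proof (dtN_le N i j HN Hij).
      pose proof (dtN_le N (j + 1) (N + 1) HN ltac:(lia)).
      repeat split; try lra.
      intros Hne; pose proof (dtN_lt N i j HN ltac:(lia)); lra. }
  split; simpl.
  - reflexivity.
  - reflexivity.
  - intros h _; unfold confR.
    replace 0 with (INR 0 + dtN N (0 + 1)) by (simpl; rewrite D1; ring).
    now rewrite tick_dtN.
  - intros t i Hi; unfold confR; rewrite traj_at_site, coords_emb.
    pose proof (dtN_bounds N i Hi).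
    pose proof (dtN_lt N i (i + 1) HN ltac:(lia)).
    pose proof (dtN_le N (i + 1) (N + 1) HN ltac:(lia)).
    rewrite (velo_before _ _ _ (Z.of_nat t)) by (rewrite <- INR_IZR_INZ; lra).
    rewrite (velo_before _ _ _ (Z.of_nat t - 1))
      by (rewrite minus_IZR, <- INR_IZR_INZ; lra).
    replace i with (i - 1 + 1)%nat by lia.
    rewrite tick_dtN, rot_emb by (auto using conf_sign).
    f_equal; apply HD; lia.
  - intros t i j Hi Hj Hne.
    destruct (Hlast t i j Hi Hj) as (m & A & B & E).
    pose proof (dtN_le N j (j + 1) HN ltac:(lia)); specialize (E Hne).
    rewrite !(velo_before _ _ _ m) by lra; reflexivity.
  - intros t i j s Hi Hj Hs.
    destruct (Hlast t i j Hi Hj) as (m & A & B & _).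
    rewrite (velo_before _ _ _ m), !(traj_linear _ _ _ _ m) by (auto || lra).
    unfold vadd, vscal; simpl; f_equal; ring.
  - intros t j h Hj Hs Hh; unfold confR.
    rewrite traj_at_site in Hh; subst h; rewrite coords_emb.
    replace j with (j - 1 + 1)%nat by lia.
    rewrite !tick_dtN, Nat.add_assoc, conf_step by lia.
    destruct (Zpair_eq_dec _ _) as [_|n]; [reflexivity | contradiction].
  - intros t j h Hj Hs Hh; unfold confR.
    apply site_iff_emb in Hs as [p ->]; rewrite coords_emb.
    rewrite traj_at_site in Hh.
    replace j with (j - 1 + 1)%nat in Hh |- * by lia.
    rewrite !tick_dtN, Nat.add_assoc, conf_step by lia.
    destruct (Zpair_eq_dec _ _) as [->|n]; [contradiction | reflexivity].
Qed.

(** * Two particles and time reversal *)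

Open Scope Z_scope.

(* A particle is the site that it reaches next, together with its velocity. *)
Definition particle : Type := ((Z * Z) * (Z * Z))%type.

Definition scatter (z : Z) (p : particle) : particle :=
  (padd (fst p) (rotZ z (snd p)), rotZ z (snd p)).

Definition flip (h : Z * Z) (c : Z * Z -> Z) (x : Z * Z) : Z :=
  if Zpair_eq_dec x h then - c x else c x.

(* The first of the two particles is the next one to be scattered. *)
Definition state : Type := ((Z * Z -> Z) * particle * particle)%type.

Definition config (s : state) : Z * Z -> Z := fst (fst s).

Definition next (s : state) : particle := snd (fst s).

Definition half_step (s : state) : state :=
  (flip (fst (next s)) (config s), snd s,
   scatter (config s (fst (next s))) (next s)).

Definition turn_back (p : particle) : particle :=
  (padd (fst p) (popp (snd p)), popp (snd p)).

(** The particles change places because the last scattering is to be undone first, and [half_step]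
    has put its particle second. *)
Definition reverse (s : state) : state :=
  (config s, turn_back (snd s), turn_back (next s)).

Definition signs (c : Z * Z -> Z) : Prop := forall h, c h = -1 \/ c h = 1.

Lemma signs_flip (h : Z * Z) (c : Z * Z -> Z) : signs c -> signs (flip h c).
Proof.
  intros Hc x; unfold flip; specialize (Hc x).
  destruct (Zpair_eq_dec x h); lia.
Qed.

Lemma flip_flip (h : Z * Z) (c : Z * Z -> Z) : flip h (flip h c) = c.
Proof.
  apply functional_extensionality; intros x; unfold flip.
  destruct (Zpair_eq_dec x h); lia.
Qed.

Lemma padd_popp (x d : Z * Z) : padd (padd x d) (popp d) = x.
Proof. destruct x, d; unfold padd, popp; simpl; f_equal; lia. Qed.

Lemma popp_padd (x d : Z * Z) : padd (padd x (popp d)) d = x.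
Proof. destruct x, d; unfold padd, popp; simpl; f_equal; lia. Qed.

Lemma popp_popp (d : Z * Z) : popp (popp d) = d.
Proof. destruct d; unfold popp; simpl; f_equal; lia. Qed.

Lemma rotZ_back (z : Z) (d : Z * Z) :
  z = -1 \/ z = 1 -> rotZ (- z) (popp (rotZ z d)) = popp d.
Proof.
  destruct d; intros [-> | ->]; unfold rotZ, popp; simpl; f_equal; lia.
Qed.

Lemma turn_back_turn_back (p : particle) : turn_back (turn_back p) = p.
Proof.
  destruct p as [x d]; unfold turn_back; simpl.
  now rewrite popp_popp, popp_padd.
Qed.

(** The particle just scattered runs back to the same scatterer, now flipped: the opposite rotation
    sends it back the way it came, and the second flip restores the scatterer. *)
Lemma half_step_reverse (s : state) :
  signs (config s) -> half_step (reverse (half_step s)) = reverse s.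
Proof.
  destruct s as [[c [x d]] q]; unfold reverse, half_step, config, next; simpl.
  intros Hc; rewrite padd_popp, flip_flip.
  unfold flip; destruct (Zpair_eq_dec x x) as [_|n]; [|congruence].
  unfold scatter, turn_back; simpl; now rewrite rotZ_back, padd_popp by apply Hc.
Qed.

Lemma signs_iter (n : nat) (s : state) :
  signs (config s) -> signs (config (Nat.iter n half_step s)).
Proof.
  intros Hs; induction n as [|n IH]; [exact Hs | now apply signs_flip].
Qed.

Lemma iter_reverse (n : nat) (s : state) :
  signs (config s) ->
  Nat.iter n half_step (reverse (Nat.iter n half_step s)) = reverse s.
Proof.
  intros Hs; induction n as [|n IH]; [reflexivity|].
  rewrite Nat.iter_succ_r; simpl.
  now rewrite half_step_reverse by now apply signs_iter.
Qed.

Definition head_on (p q : particle) : Prop := p = turn_back q.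

Lemma reverse_head_on (s : state) :
  head_on (next s) (snd s) -> reverse s = s.
Proof.
  destruct s as [[c p] q]; unfold reverse, head_on, config, next; simpl.
  intros ->; now rewrite turn_back_turn_back.
Qed.

(** The state after [n] half steps is its own reverse, so [n] more half steps lead to the reverse of
    [s], which is [s] itself. *)
Lemma head_on_periodic (n : nat) (s : state) :
  signs (config s) -> head_on (next s) (snd s) ->
  head_on (next (Nat.iter n half_step s)) (snd (Nat.iter n half_step s)) ->
  Nat.iter (n + n) half_step s = s.
Proof.
  intros Hs H0 H1; rewrite Nat.iter_add.
  rewrite <- (reverse_head_on _ H1), iter_reverse by exact Hs.
  now apply reverse_head_on.
Qed.

(** * Prescribed turns *)

(** The motion when a word dictates the turns, without any configuration. *)
Fixpoint follow (w : list Z) (p q : particle) : particle * particle :=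
  match w with
  | nil => (p, q)
  | z :: w => follow w q (scatter z p)
  end.

Definition memory : Type := list ((Z * Z) * Z).

Fixpoint lookup (m : memory) (h : Z * Z) : option Z :=
  match m with
  | nil => None
  | (x, z) :: m => if Zpair_eq_dec h x then Some z else lookup m h
  end.

(* The memory records the current states of the scatterers met so far; [exec]
   fails if a turn contradicts it, or at a site outside [dom]. *)
Fixpoint exec (dom : Z * Z -> bool) (m : memory) (w : list Z) (p q : particle)
  : option (memory * (particle * particle)) :=
  match w with
  | nil => Some (m, (p, q))
  | z :: w =>
      if (dom (fst p) &&
          match lookup m (fst p) with None => true | Some s => s =? z end)%bool
      then exec dom ((fst p, - z) :: m) w q (scatter z p) else None
  end.

Definition everywhere (h : Z * Z) : bool := true.

Definition is_sign (z : Z) : Prop := z = -1 \/ z = 1.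

Lemma exec_follow dom w m p q m' r :
  exec dom m w p q = Some (m', r) -> follow w p q = r.
Proof.
  revert m p q; induction w as [|z w IH]; simpl; intros m p q E.
  - congruence.
  - destruct (_ && _)%bool; [eauto | discriminate].
Qed.

Lemma exec_app dom w1 w2 m p q m' p' q' :
  exec dom m w1 p q = Some (m', (p', q')) ->
  exec dom m (w1 ++ w2) p q = exec dom m' w2 p' q'.
Proof.
  revert m p q; induction w1 as [|z w IH]; simpl; intros m p q E.
  - congruence.
  - destruct (_ && _)%bool; [eauto | discriminate].
Qed.

(* Running backwards through the word, each turn dictates the state in which
   its scatterer has to be before the visit. *)
Lemma exec_realizable dom w m p q r :
  Forall is_sign w -> (forall h z, lookup m h = Some z -> is_sign z) ->
  exec dom m w p q = Some r ->
  exists c, signs c /\ (forall h z, lookup m h = Some z -> c h = z) /\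
    forall w1 w2, w = w1 ++ w2 -> exists c',
      Nat.iter (length w1) half_step (c, p, q) = (c', fst (follow w1 p q),
                                                  snd (follow w1 p q)).
Proof.
  revert m p q; induction w as [|z w IH]; simpl; intros m p q Hw Hm E.
  (* Sites missing from the final memory may have any orientation; 1 is chosen. *)
  - exists (fun h => match lookup m h with Some z => z | None => 1 end).
    repeat split.
    + intros h; specialize (Hm h); destruct (lookup m h); [now apply Hm | lia].
    + now intros h z ->.
    + intros [|? ?] w2 E'; [|discriminate]; simpl; eauto.
  - inversion Hw as [|? ? Hz Hw']; subst.
    destruct (dom (fst p)); [|discriminate].
    destruct (match lookup m (fst p) with None => true | Some s => s =? z end)
      eqn:Ez; [|discriminate].
    destruct (IH ((fst p, - z) :: m) q (scatter z p)) as (c & Hc & Ac & Fc);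
      [assumption | | assumption |].
    { intros h y; simpl; destruct (Zpair_eq_dec h (fst p)); [|apply Hm].
      intros Ey; unfold is_sign in *; injection Ey; lia. }
    assert (Cz : c (fst p) = - z).
    { apply Ac; simpl; now destruct (Zpair_eq_dec (fst p) (fst p)). }
    assert (Fz : flip (fst p) c (fst p) = z).
    { unfold flip; destruct (Zpair_eq_dec _ _); [lia | congruence]. }
    exists (flip (fst p) c); split; [now apply signs_flip | split].
    + intros h y Ey; destruct (Zpair_eq_dec h (fst p)) as [-> | n].
      * rewrite Ey in Ez; apply Z.eqb_eq in Ez; congruence.
      * unfold flip; destruct (Zpair_eq_dec h (fst p)); [contradiction|].
        apply Ac; simpl; now destruct (Zpair_eq_dec h (fst p)).
    + intros [|z' w1] w2 E'; [simpl; eauto|].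
      injection E' as <- E'.
      change (length (z :: w1)) with (S (length w1)); rewrite Nat.iter_succ_r.
      unfold half_step at 2; unfold config, next; cbn [fst snd].
      rewrite flip_flip, Fz; apply (Fc _ _ E').
Qed.

Definition move (o : Z * Z) (p : particle) : particle := (padd (fst p) o, snd p).

(** Absent entries are compared too: sites of [dom] unknown to [m0] must be fresh for [m]. *)
Definition looks_like (dom : Z * Z -> bool) (o : Z * Z) (m m0 : memory) : Prop :=
  forall h, dom h = true -> lookup m (padd h o) = lookup m0 h.

Lemma padd_inj (x y o : Z * Z) : padd x o = padd y o -> x = y.
Proof.
  destruct x, y, o; unfold padd; simpl; intros E; injection E; intros;
  f_equal; lia.
Qed.

Lemma scatter_move z o p : scatter z (move o p) = move o (scatter z p).
Proof.
  destruct p as [[] d], o; unfold scatter, move, padd; simpl.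
  do 2 f_equal; lia.
Qed.

(** A run that stays in [dom] consults the memory only there; the translated run reads the same
    entries and records the same ones. Thus one computation with [m0] carries over to any longer
    past. *)
Lemma exec_move dom o w m m0 p q m0' p' q' :
  looks_like dom o m m0 ->
  exec dom m0 w p q = Some (m0', (p', q')) ->
  exists m', exec everywhere m w (move o p) (move o q)
             = Some (m', (move o p', move o q')) /\ looks_like dom o m' m0'.
Proof.
  revert m m0 p q; induction w as [|z w IH]; simpl; intros m m0 p q Hm E.
  - injection E as <- <- <-; eauto.
  - destruct (dom (fst p)) eqn:Hd; [|discriminate].
    rewrite Hm by exact Hd; simpl in E |- *.
    destruct (match lookup m0 (fst p) with None => _ | _ => _ end);
      [|discriminate].
    rewrite scatter_move; apply (IH _ _ _ _) with (2 := E).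
    intros h Hh; unfold move; simpl.
    destruct (Zpair_eq_dec (padd h o) (padd (fst p) o)) as [e|n],
      (Zpair_eq_dec h (fst p)) as [e'|n']; try congruence.
    + now apply padd_inj in e.
    + now apply Hm.
Qed.

(** A decidable form of [looks_like]: outside the sites occurring in the two memories both lookups
    give [None]. *)
Definition same_entries (dom : Z * Z -> bool) (o : Z * Z) (m m0 : memory)
  : bool :=
  forallb (fun h => implb (dom h)
    match lookup m (padd h o), lookup m0 h with
    | Some y, Some z => y =? z
    | None, None => true
    | _, _ => false
    end)
    (map (fun e => padd (fst e) (popp o)) m ++ map fst m0).

Lemma lookup_not_in m h : ~ In h (map fst m) -> lookup m h = None.
Proof.
  induction m as [|[x z] m IH]; simpl; [reflexivity|].
  intros H; destruct (Zpair_eq_dec h x) as [->|n]; tauto.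
Qed.

Lemma same_entries_looks_like dom o m m0 :
  same_entries dom o m m0 = true -> looks_like dom o m m0.
Proof.
  intros Hs h Hh; unfold same_entries in Hs; rewrite forallb_forall in Hs.
  set (keys := map (fun e => padd (fst e) (popp o)) m ++ map fst m0) in Hs.
  destruct (in_dec Zpair_eq_dec h keys) as [Hi|Hi].
  - specialize (Hs h Hi); rewrite Hh in Hs; simpl in Hs.
    destruct (lookup m (padd h o)), (lookup m0 h); try discriminate.
    + apply Z.eqb_eq in Hs; congruence.
    + reflexivity.
  - unfold keys in Hi; rewrite in_app_iff in Hi.
    rewrite !lookup_not_in; [reflexivity | tauto |].
    intros Hk; apply Hi; left; apply in_map_iff in Hk as (e & He & Hin).
    apply in_map_iff; exists e; split; [rewrite He; apply padd_popp | exact Hin].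
Qed.

(** * The glider *)

(* The words below were found by a computer search. *)
Definition approach_start : particle * particle :=
  (((-2, -2), (1, 0)), ((-3, -2), (-1, 0))).

Definition glider_start : particle * particle :=
  (((0, 0), (-1, 1)), ((0, 1), (0, 1))).

(** Two turns per unit of time make a period of 27. The last 27 turns are the opposites of the first
    27. *)
Definition glider_turns : list Z :=
  [1; -1; -1; -1; 1; -1; -1; -1; -1; 1; 1; -1; 1; 1; 1; 1; -1; -1;
   1; 1; 1; -1; 1; -1; -1; -1; 1; -1; 1; 1; 1; -1; 1; 1; 1; 1;
   -1; -1; 1; -1; -1; -1; -1; 1; 1; -1; -1; -1; 1; -1; 1; 1; 1; -1].

(** Six turns lead from the head-on state to [glider_start] translated by (-2, -2); a first glider
    period then lays down the [wake]. *)
Definition approach_turns : list Z := [1; 1; -1; 1; -1; -1] ++ glider_turns.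

Definition final_turns : list Z := [1; 1; -1].

(** A half-plane containing every scattering of a glider period begun at [glider_start], and mapped
    into itself by the translation [velocity]. *)
Definition ahead (h : Z * Z) : bool := 0 <=? fst h + snd h.

(* All that the glider sees of its past: the sites [h] with [ahead h] that
   it has visited, with their states. *)
Definition wake : memory := [((-1, 1), -1); ((0, 0), 1); ((1, -1), -1); ((1, 0), -1)].

Definition velocity : Z * Z := (2, 2).

Lemma approach_exec :
  exists m, exec everywhere nil approach_turns (fst approach_start)
              (snd approach_start) = Some (m, glider_start) /\
            looks_like ahead (0, 0) m wake.
Proof.
  eexists; split; [vm_compute; reflexivity|].
  apply same_entries_looks_like; vm_compute; reflexivity.
Qed.

(** Not only the pair but also the visible part of its past recurs in translated form; this is what
    lets the period be iterated. *)
Lemma glider_exec :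
  exists m, exec ahead wake glider_turns (fst glider_start) (snd glider_start)
            = Some (m, (move velocity (fst glider_start),
                        move velocity (snd glider_start))) /\
            looks_like ahead velocity m wake.
Proof.
  eexists; split; [vm_compute; reflexivity|].
  apply same_entries_looks_like; vm_compute; reflexivity.
Qed.

Lemma final_exec :
  exists m p q,
    exec ahead wake final_turns (fst glider_start) (snd glider_start)
    = Some (m, (p, q)) /\ head_on p q.
Proof.
  do 3 eexists; split; [vm_compute; reflexivity | vm_compute; reflexivity].
Qed.

Definition repeat_turns (k : nat) : list Z := concat (repeat glider_turns k).

Definition times (k : nat) : Z * Z :=
  (Z.of_nat k * fst velocity, Z.of_nat k * snd velocity).

Lemma repeat_turns_add (j k : nat) :
  repeat_turns (j + k) = repeat_turns j ++ repeat_turns k.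
Proof. unfold repeat_turns; now rewrite repeat_app, concat_app. Qed.

Lemma repeat_turns_succ (k : nat) :
  repeat_turns (S k) = glider_turns ++ repeat_turns k.
Proof. reflexivity. Qed.

Lemma padd_assoc (x y z : Z * Z) : padd (padd x y) z = padd x (padd y z).
Proof. unfold padd; simpl; f_equal; lia. Qed.

Lemma padd_comm (x y : Z * Z) : padd x y = padd y x.
Proof. unfold padd; f_equal; lia. Qed.

Lemma move_move (o o' : Z * Z) (p : particle) :
  move o (move o' p) = move (padd o' o) p.
Proof. unfold move; simpl; now rewrite padd_assoc. Qed.

Lemma ahead_velocity (h : Z * Z) :
  ahead h = true -> ahead (padd h velocity) = true.
Proof. unfold ahead, padd; rewrite !Z.leb_le; simpl; lia. Qed.

Lemma repeat_exec (k : nat) (m : memory) (o : Z * Z) :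
  looks_like ahead o m wake ->
  exists m', exec everywhere m (repeat_turns k) (move o (fst glider_start))
               (move o (snd glider_start))
             = Some (m', (move (padd (times k) o) (fst glider_start),
                          move (padd (times k) o) (snd glider_start))) /\
             looks_like ahead (padd (times k) o) m' wake.
Proof.
  revert m o; induction k as [|k IH]; intros m o Hm.
  - exists m; replace (padd (times 0) o) with o by now destruct o.
    now split.
  - destruct glider_exec as (m1 & E1 & L1).
    destruct (exec_move _ _ _ _ _ _ _ _ _ _ Hm E1) as (m2 & E2 & L2).
    rewrite !move_move in E2.
    destruct (IH m2 (padd velocity o)) as (m3 & E3 & L3).
    (* Sites ahead after the period were ahead before it, so the two translated comparisons
       compose. *)
    { intros h Hh; rewrite <- padd_assoc, L2 by now apply ahead_velocity.
      now apply L1. }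
    exists m3; rewrite repeat_turns_succ, (exec_app _ _ _ _ _ _ _ _ _ E2), E3.
    replace (padd (times (S k)) o) with (padd (times k) (padd velocity o)).
    + now split.
    + destruct o; unfold padd, times; cbn [fst snd velocity]; f_equal; lia.
Qed.

Lemma glider_run (k : nat) :
  exists m,
    exec everywhere [] (approach_turns ++ repeat_turns k) (fst approach_start)
      (snd approach_start)
    = Some (m, (move (times k) (fst glider_start),
                move (times k) (snd glider_start))) /\
    looks_like ahead (times k) m wake.
Proof.
  destruct approach_exec as (m & E & L).
  destruct (repeat_exec k m (0, 0) L) as (m' & E' & L').
  exists m'.
  rewrite (exec_app _ _ _ _ _ _ _ (fst glider_start) (snd glider_start) E).
  replace (padd (times k) (0, 0)) with (times k) in E', L'
    by (unfold times, padd; simpl; f_equal; lia).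
  now split.
Qed.

Lemma glider_length : length glider_turns = 54%nat.
Proof. reflexivity. Qed.

Lemma approach_length : length approach_turns = 60%nat.
Proof. reflexivity. Qed.

Lemma repeat_length (k : nat) : length (repeat_turns k) = (k * 54)%nat.
Proof.
  induction k as [|k IH]; [reflexivity|].
  rewrite repeat_turns_succ, length_app, IH, glider_length; lia.
Qed.

Lemma turns_are_signs (k : nat) :
  Forall is_sign (approach_turns ++ repeat_turns k ++ final_turns).
Proof.
  assert (G : Forall is_sign approach_turns)
    by (repeat (apply Forall_cons; [unfold is_sign; lia|]); apply Forall_nil).
  apply Forall_app; split; [exact G|]; apply Forall_app; split.
  - apply Forall_app in G as [_ G].
    induction k as [|k IH]; [constructor|].
    rewrite repeat_turns_succ; apply Forall_app; now split.
  - repeat (apply Forall_cons; [unfold is_sign; lia|]); apply Forall_nil.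
Qed.

Definition unit_state (s : state) : Prop :=
  unit_direction (snd (next s)) /\ unit_direction (snd (snd s)).

(** Approach, [k] glides and final turns join two head-on states, so the length [n] of this word is
    half a period, counted in half steps. The sites [times j] will bound the size from below. *)
Lemma large_periodic_orbit (k : nat) :
  exists (s : state) (n : nat),
    signs (config s) /\ unit_state s /\
    Nat.iter (n + n) half_step s = s /\ (0 < n)%nat /\
    forall j : nat, (j <= k)%nat -> exists t : nat,
      fst (next (Nat.iter (2 * t) half_step s)) = times j.
Proof.
  pose proof (turns_are_signs k) as Hw.
  remember (approach_turns ++ repeat_turns k ++ final_turns) as w eqn:Dw.
  destruct (glider_run k) as (m & E & L).
  destruct final_exec as (mf & p & q & Ef & Hpq).
  destruct (exec_move _ _ _ _ _ _ _ _ _ _ L Ef) as (mf' & Ef' & _).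
  assert (Ew : exec everywhere [] w (fst approach_start) (snd approach_start)
          = Some (mf', (move (times k) p, move (times k) q))).
  { rewrite Dw, app_assoc, (exec_app _ _ _ _ _ _ _ _ _ E); exact Ef'. }
  assert (H0 : forall h z, lookup [] h = Some z -> is_sign z) by discriminate.
  destruct (exec_realizable _ _ _ _ _ _ Hw H0 Ew) as (c & Hc & _ & Fc).
  exists (c, fst approach_start, snd approach_start), (length w).
  split; [exact Hc|]; split; [split; reflexivity|].
  split; [|split].
  - apply head_on_periodic; [exact Hc | reflexivity |].
    destruct (Fc w []) as (c' & ->); [now rewrite app_nil_r|].
    rewrite (exec_follow _ _ _ _ _ _ _ Ew); unfold next, head_on; simpl.
    rewrite Hpq; unfold move, turn_back; simpl; f_equal.
    rewrite !padd_assoc; f_equal; apply padd_comm.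
  - rewrite Dw, length_app, approach_length; lia.
  (* The approach takes 60 scatterings and each glide 54, at two per unit of time. *)
  - intros j Hj; exists (30 + j * 27)%nat.
    destruct (Fc (approach_turns ++ repeat_turns j)
                 (repeat_turns (k - j) ++ final_turns)) as (c' & Ec).
    { rewrite Dw, <- app_assoc, (app_assoc (repeat_turns j)).
      now rewrite <- repeat_turns_add, (Nat.add_comm j), Nat.sub_add. }
    destruct (glider_run j) as (mj & Ej & _).
    rewrite (exec_follow _ _ _ _ _ _ _ Ej) in Ec.
    rewrite length_app, approach_length, repeat_length in Ec.
    replace (2 * (30 + j * 27))%nat with (60 + j * 54)%nat by lia.
    rewrite Ec; unfold next; simpl; unfold times, padd; simpl.
    f_equal; lia.
Qed.

(** * From the periodic orbit to the multiparticle model *)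

(** Reduction modulo the period extends the orbit to the negative indices that [traj] uses. *)
Definition orbit (s0 : state) (n : nat) (k : Z) : state :=
  Nat.iter (Z.to_nat (k mod (2 * Z.of_nat n))) half_step s0.

(** The first particle is next to be scattered at even indices, the second at odd ones. *)
Definition first_of (s0 : state) (n : nat) (t : Z) : particle :=
  next (orbit s0 n (2 * t)).

Definition second_of (s0 : state) (n : nat) (t : Z) : particle :=
  next (orbit s0 n (2 * t + 1)).

Lemma orbit_succ (s0 : state) (n : nat) (k : Z) :
  (0 < n)%nat -> Nat.iter (n + n) half_step s0 = s0 ->
  orbit s0 n (k + 1) = half_step (orbit s0 n k).
Proof.
  intros Hn Hs; unfold orbit; set (P := 2 * Z.of_nat n).
  assert (HP : 0 < P) by (unfold P; lia).
  pose proof (Z.mod_pos_bound k P HP).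
  rewrite <- Z.add_mod_idemp_l by lia.
  destruct (Z.eq_dec (k mod P + 1) P) as [e|ne].
  - rewrite e, Z_mod_same_full; simpl Nat.iter at 1.
    rewrite <- Hs at 1.
    replace (n + n)%nat with (S (Z.to_nat (k mod P))) by lia; reflexivity.
  - rewrite (Z.mod_small (k mod P + 1)) by lia.
    now replace (Z.to_nat (k mod P + 1)) with (S (Z.to_nat (k mod P))) by lia.
Qed.

Lemma orbit_iter (s0 : state) (n k : nat) :
  (0 < n)%nat -> Nat.iter (n + n) half_step s0 = s0 ->
  orbit s0 n (Z.of_nat k) = Nat.iter k half_step s0.
Proof.
  intros Hn Hs; induction k as [|k IH].
  - unfold orbit; now rewrite Z.mod_0_l by lia.
  - rewrite Nat2Z.inj_succ; unfold Z.succ; rewrite orbit_succ, IH by assumption.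
    reflexivity.
Qed.

Lemma orbit_shift (s0 : state) (n : nat) (k : Z) :
  (0 < n)%nat -> orbit s0 n (k + 2 * Z.of_nat n) = orbit s0 n k.
Proof.
  intros Hn; unfold orbit; do 2 f_equal.
  rewrite <- (Z.mul_1_l (2 * Z.of_nat n)) at 1; apply Z_mod_plus_full.
Qed.

Lemma first_succ (s0 : state) (n : nat) (t : Z) :
  (0 < n)%nat -> Nat.iter (n + n) half_step s0 = s0 ->
  first_of s0 n (t + 1)
  = scatter (config (orbit s0 n (2 * t)) (fst (first_of s0 n t)))
            (first_of s0 n t).
Proof.
  intros Hn Hs; unfold first_of.
  replace (2 * (t + 1)) with (2 * t + 1 + 1) by lia.
  now rewrite !orbit_succ by assumption.
Qed.

Lemma second_succ (s0 : state) (n : nat) (t : Z) :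
  (0 < n)%nat -> Nat.iter (n + n) half_step s0 = s0 ->
  second_of s0 n (t + 1)
  = scatter (config (orbit s0 n (2 * t + 1)) (fst (second_of s0 n t)))
            (second_of s0 n t).
Proof.
  intros Hn Hs; unfold second_of.
  replace (2 * (t + 1) + 1) with (2 * t + 1 + 1 + 1) by lia.
  now rewrite !(orbit_succ s0 n (_ + 1)) by assumption.
Qed.

Lemma unit_rotZ (z : Z) (d : Z * Z) :
  unit_direction d -> unit_direction (rotZ z d).
Proof.
  unfold unit_direction, rotZ; destruct d, (z =? 1); simpl; lia.
Qed.

Lemma unit_orbit (s0 : state) (n : nat) (k : Z) :
  unit_state s0 -> unit_state (orbit s0 n k).
Proof.
  intros Hu; unfold orbit; generalize (Z.to_nat (k mod (2 * Z.of_nat n))).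
  intros j; induction j as [|j [IH1 IH2]]; [exact Hu|].
  split; [exact IH2 | now apply unit_rotZ].
Qed.

Lemma orbit_bounded (s0 : state) (n : nat) :
  (0 < n)%nat ->
  exists b : Z, forall k, fst (fst (next (orbit s0 n k))) <= b.
Proof.
  intros Hn.
  assert (B : forall l : nat, exists b : Z, forall j, (j < l)%nat ->
     fst (fst (next (Nat.iter j half_step s0))) <= b).
  { induction l as [|l [b IH]]; [exists 0; lia|].
    exists (Z.max b (fst (fst (next (Nat.iter l half_step s0))))).
    intros j Hj; destruct (Nat.eq_dec j l) as [->|ne]; [lia|].
    specialize (IH j ltac:(lia)); lia. }
  destruct (B (n + n)%nat) as [b Hb]; exists b; intros k; apply Hb.
  pose proof (Z.mod_pos_bound k (2 * Z.of_nat n) ltac:(lia)); lia.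
Qed.

(* The particles from the third on move along zigzags with pairwise disjoint
   sets of sites, all beyond the abscissa [b]. *)
Definition sites_of (s0 : state) (n : nat) (b : Z) (i : nat) (t : Z) : Z * Z :=
  match i with
  | 1%nat => fst (first_of s0 n t)
  | 2%nat => fst (second_of s0 n t)
  | _ => (b + 2 * Z.of_nat i + t mod 2, t / 2)
  end.

(** A heading is the velocity after the scattering, whereas a [particle] carries the one before it;
    hence [t + 1]. *)
Definition headings_of (s0 : state) (n : nat) (i : nat) (t : Z) : Z * Z :=
  match i with
  | 1%nat => snd (first_of s0 n (t + 1))
  | 2%nat => snd (second_of s0 n (t + 1))
  | _ => if t mod 2 =? 0 then (1, 0) else (-1, 1)
  end.

(** Beyond [b] the parity of the column dictates the zigzags: a right turn onto (1, 0), then a left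
    turn onto (-1, 1). *)
Definition full_config (s0 : state) (b : Z) (h : Z * Z) : Z :=
  if fst h <=? b then config s0 h
  else if (fst h - b) mod 2 =? 0 then 1 else -1.

Ltac zlia := Z.div_mod_to_equations; lia.

Record periodic_pair (s0 : state) (n : nat) (b : Z) : Prop := {
  pair_time : (0 < n)%nat;
  pair_period : Nat.iter (n + n) half_step s0 = s0;
  pair_bound : forall k, fst (fst (next (orbit s0 n k))) <= b;
  pair_signs : signs (config s0);
  pair_unit : unit_state s0
}.

Lemma full_config_signs s0 n b :
  periodic_pair s0 n b -> signs (full_config s0 b).
Proof.
  intros [_ _ _ Hsig _] h; unfold full_config.
  destruct (fst h <=? b); [apply Hsig | destruct (_ =? 0); lia].
Qed.

Lemma sites_of_next s0 n b i t :
  periodic_pair s0 n b ->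
  sites_of s0 n b i (t + 1) = padd (sites_of s0 n b i t) (headings_of s0 n i t).
Proof.
  intros [Hn Hper _ _ _].
  destruct i as [|[|[|i]]]; unfold sites_of, headings_of.
  - destruct (Z.eqb_spec (t mod 2) 0); unfold padd; cbn [fst snd]; f_equal; zlia.
  - now rewrite first_succ.
  - now rewrite second_succ.
  - destruct (Z.eqb_spec (t mod 2) 0); unfold padd; cbn [fst snd]; f_equal; zlia.
Qed.

Lemma headings_of_unit s0 n b i t :
  periodic_pair s0 n b -> unit_direction (headings_of s0 n i t).
Proof.
  intros [_ _ _ _ Hunit]; destruct i as [|[|[|i]]]; unfold headings_of.
  - destruct (_ =? 0); reflexivity.
  - apply unit_orbit, Hunit.
  - apply unit_orbit, Hunit.
  - destruct (_ =? 0); reflexivity.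
Qed.

Lemma sites_of_beyond s0 n b i t :
  (2 < i)%nat -> b < fst (sites_of s0 n b i t).
Proof.
  intros Hi; destruct i as [|[|[|i]]]; try lia.
  unfold sites_of; cbn [fst]; zlia.
Qed.

(** The other particles stay beyond [b], so up to [b] only the first two scatterings of each unit of
    time act; hence [Nat.min j 2]. *)
Lemma conf_pair s0 n b N h :
  periodic_pair s0 n b -> (2 <= N)%nat -> fst h <= b ->
  forall t j : nat, (j <= N)%nat ->
  conf N (sites_of s0 n b) (full_config s0 b) (t * N + j) h
  = config (orbit s0 n (2 * Z.of_nat t + Z.of_nat (Nat.min j 2))) h.
Proof.
  intros [Hn Hper _ _ _] HN Hh.
  set (H := sites_of s0 n b); set (c0 := full_config s0 b).
  assert (Step : forall t : nat,
    conf N H c0 (t * N) h = config (orbit s0 n (2 * Z.of_nat t)) h ->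
    forall j, (j <= N)%nat -> conf N H c0 (t * N + j) h
    = config (orbit s0 n (2 * Z.of_nat t + Z.of_nat (Nat.min j 2))) h).
  { intros t Ht; induction j as [|j IH]; intros Hj.
    - now rewrite Nat.add_0_r, Z.add_0_r.
    - rewrite <- (Nat.add_1_r j), Nat.add_assoc, conf_step, IH by lia.
      destruct j as [|[|j]].
      + replace (2 * Z.of_nat t + Z.of_nat (Nat.min (0 + 1) 2))
          with (2 * Z.of_nat t + 1) by lia.
        rewrite orbit_succ, Z.add_0_r by assumption; reflexivity.
      + replace (2 * Z.of_nat t + Z.of_nat (Nat.min (1 + 1) 2))
          with (2 * Z.of_nat t + 1 + 1) by lia.
        rewrite (orbit_succ _ _ (_ + 1)) by assumption; reflexivity.
      + replace (Nat.min (S (S j) + 1) 2) with (Nat.min (S (S j)) 2) by lia.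
        destruct (Zpair_eq_dec _ _) as [e|_]; [|reflexivity].
        pose proof (sites_of_beyond s0 n b (S (S j) + 1) (Z.of_nat t) ltac:(lia)).
        fold H in H0; rewrite <- e in H0; lia. }
  induction t as [|t IH]; intros j Hj; apply Step; try exact Hj.
  - simpl; unfold c0, full_config.
    destruct (Z.leb_spec (fst h) b); [|lia].
    change 0 with (Z.of_nat 0); now rewrite orbit_iter.
  - replace (S t * N)%nat with (t * N + N)%nat by lia.
    rewrite IH by lia; do 2 f_equal; lia.
Qed.

Lemma conf_unvisited N H c0 k h :
  (1 <= N)%nat ->
  (forall t j : nat, (j < N)%nat -> (t * N + j < k)%nat ->
     h <> H (j + 1)%nat (Z.of_nat t)) ->
  conf N H c0 k h = c0 h.
Proof.
  intros HN; induction k as [|k IH]; intros Hk; [reflexivity|]; simpl.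
  destruct (Zpair_eq_dec _ _) as [e|_].
  - pose proof (Nat.mod_upper_bound k N ltac:(lia)).
    pose proof (Nat.div_mod_eq k N).
    exfalso; apply (Hk (k / N)%nat (k mod N)%nat); [lia | lia | exact e].
  - apply IH; intros t j Hj Hl; apply Hk; lia.
Qed.

(** The pair sees the scatterers of its own orbit by [conf_pair]; a zigzag meets only unvisited
    sites, so the initial configuration decides its turns. *)
Lemma headings_of_turn s0 n b N (t j : nat) :
  periodic_pair s0 n b -> (2 <= N)%nat -> (j < N)%nat ->
  headings_of s0 n (j + 1) (Z.of_nat t)
  = rotZ (conf N (sites_of s0 n b) (full_config s0 b) (t * N + j)
            (sites_of s0 n b (j + 1) (Z.of_nat t)))
         (headings_of s0 n (j + 1) (Z.of_nat t - 1)).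
Proof.
  intros HO HN Hj; pose proof HO as [Hn Hper Hb _ _].
  destruct j as [|[|j]].
  - rewrite (conf_pair _ n) by (assumption || lia || apply Hb).
    rewrite Z.add_0_r; unfold sites_of, headings_of; simpl (0 + 1)%nat.
    cbv iota; rewrite Z.sub_add, first_succ by assumption; reflexivity.
  - rewrite (conf_pair _ n) by (assumption || lia || apply Hb).
    unfold sites_of, headings_of; simpl (1 + 1)%nat.
    cbv iota; rewrite Z.sub_add, second_succ by assumption; reflexivity.
  - rewrite conf_unvisited; [|lia|].
    + unfold sites_of, headings_of, full_config.
      replace (S (S j) + 1)%nat with (S (S (S j))) by lia; cbn [fst].
      destruct (Z.leb_spec (b + 2 * Z.of_nat (S (S (S j))) + Z.of_nat t mod 2) b);
        [zlia|].
      destruct (Z.eqb_spec (Z.of_nat t mod 2) 0),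
        (Z.eqb_spec ((Z.of_nat t - 1) mod 2) 0),
        (Z.eqb_spec ((b + 2 * Z.of_nat (S (S (S j))) + Z.of_nat t mod 2 - b)
                       mod 2) 0); try reflexivity; zlia.
    (* An earlier visitor is either in the pair, which never passes [b], or on a zigzag, where the
       site determines both particle and time. *)
    + intros t' j' Hj' Hlt e.
      pose proof (sites_of_beyond s0 n b (S (S j) + 1) (Z.of_nat t) ltac:(lia)) as Ho.
      rewrite e in Ho.
      destruct j' as [|[|j']].
      * pose proof (Hb (2 * Z.of_nat t')); simpl in Ho; unfold first_of in Ho; lia.
      * pose proof (Hb (2 * Z.of_nat t' + 1)); simpl in Ho.
        unfold second_of in Ho; lia.
      * replace (S (S j) + 1)%nat with (S (S (S j))) in e by lia.
        replace (S (S j') + 1)%nat with (S (S (S j'))) in e by lia.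
        unfold sites_of in e; injection e as e1 e2.
        assert (j' = j /\ t' = t) as [-> ->] by zlia; lia.
Qed.

(** * Period and size *)

Open Scope R_scope.

Lemma unit_direction_sides (d : Z * Z) :
  unit_direction d -> (Z.abs (fst d) = 1 \/ Z.abs (snd d) = 1)%Z.
Proof.
  destruct d as [x y]; unfold unit_direction; simpl; intros U.
  assert (-1 <= y <= 1)%Z by nia.
  assert (y = -1 \/ y = 0 \/ y = 1)%Z as [-> | [-> | ->]] by lia; [lia | nia | lia].
Qed.

Lemma fraction_of_integer (f : R) (d k : Z) :
  0 <= f < 1 -> f * IZR d = IZR k -> Z.abs d = 1%Z -> f = 0.
Proof.
  intros Hf E Hd.
  assert (Hk : exists j : Z, f = IZR j).
  { assert (d = 1 \/ d = -1)%Z as [-> | ->] by lia.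
    - exists k; lra.
    - exists (- k)%Z; rewrite opp_IZR; lra. }
  destruct Hk as [j Hj]; rewrite Hj in Hf |- *.
  destruct Hf as [Hl Hu]; apply le_IZR in Hl; apply lt_IZR in Hu.
  f_equal; lia.
Qed.

Lemma traj_IZR (H D : Z -> Z * Z) (z : Z) : traj H D 0 (IZR z) = emb (H z).
Proof.
  unfold traj; rewrite Rminus_0_r, Int_part_IZR.
  unfold vadd, vscal, emb, embR; simpl; f_equal; ring.
Qed.

(** Some coordinate changes by exactly 1 or -1 along each bond, so it is integral only at the ends.
    This will make all periods integral. *)
Lemma traj_site_integral (H D : Z -> Z * Z) (s : R) :
  (forall t, unit_direction (D t)) -> site (traj H D 0 s) ->
  exists z, s = IZR z.
Proof.
  intros HU Hs; apply site_iff_emb in Hs as [[x y] E].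
  unfold traj in E; rewrite Rminus_0_r in E.
  set (z := Int_part s) in E; set (f := s - IZR z) in E.
  assert (Hf : 0 <= f < 1)
    by (unfold f, z; destruct (base_Int_part s); lra).
  exists z; enough (f = 0) by (unfold f in *; lra).
  specialize (HU z); apply unit_direction_sides in HU.
  destruct (H z) as [x0 y0], (D z) as [dx dy].
  assert (E' : embR (IZR x0 + f * IZR dx) (IZR y0 + f * IZR dy)
               = embR (IZR x) (IZR y)).
  { fold (emb (x, y)) in E; unfold emb in E; simpl in E; rewrite <- E.
    unfold embR, vadd, vscal; simpl; f_equal; field. }
  apply embR_inj in E' as [Ex Ey]; simpl in HU; destruct HU as [U|U].
  - apply (fraction_of_integer f dx (x - x0)); [exact Hf | | exact U].
    rewrite minus_IZR; lra.
  - apply (fraction_of_integer f dy (y - y0)); [exact Hf | | exact U].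
    rewrite minus_IZR; lra.
Qed.

Lemma padd_cancel (x d d' : Z * Z) : padd x d = padd x d' -> d = d'.
Proof. rewrite !(padd_comm x); apply padd_inj. Qed.

Definition site_period (H : Z -> Z * Z) (p : nat) : Prop :=
  (0 < p)%nat /\ forall t, (0 <= t)%Z -> H (t + Z.of_nat p)%Z = H t.

Lemma recurs_after_site_period (H D : Z -> Z * Z) (p : nat) :
  (forall t, H (t + 1)%Z = padd (H t) (D t)) ->
  site_period H p -> recurs_after (traj H D 0) (INR p).
Proof.
  intros HH [Hp HP]; split; [now apply lt_0_INR|]; intros s Hs.
  (* Headings are differences of successive sites and recur with them. *)
  assert (HD : forall t, (0 <= t)%Z -> D (t + Z.of_nat p)%Z = D t).
  { intros t Ht; apply (padd_cancel (H t)); rewrite <- HH.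
    rewrite <- (HP t), <- (HP (t + 1)%Z), <- HH by lia; f_equal; lia. }
  set (z := Int_part s).
  assert (Hz : 0 <= s - IZR z < 1)
    by (unfold z; destruct (base_Int_part s); lra).
  assert (0 <= z)%Z by (enough (-1 < z)%Z by lia; apply lt_IZR; lra).
  rewrite (traj_linear H D 0 s z) by (assumption || lra).
  rewrite (traj_linear H D 0 _ (z + Z.of_nat p))
    by (assumption || (rewrite plus_IZR, <- INR_IZR_INZ; lra)).
  rewrite HP, HD by assumption; do 2 f_equal.
  rewrite plus_IZR, <- INR_IZR_INZ; ring.
Qed.

Lemma site_period_recurs_after (H D : Z -> Z * Z) (tau : R) :
  (forall t, unit_direction (D t)) ->
  recurs_after (traj H D 0) tau -> exists p, tau = INR p /\ site_period H p.
Proof.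
  intros HU [Htau Hrec].
  (* The motion starts at a site and is there again at time [tau], which is therefore an integer. *)
  assert (Hs : site (traj H D 0 tau)).
  { apply site_iff_emb; exists (H 0%Z); rewrite <- (traj_IZR H D).
    rewrite <- (Hrec 0) by lra; f_equal; ring. }
  destruct (traj_site_integral H D tau HU Hs) as [z ->].
  apply lt_IZR in Htau; exists (Z.to_nat z).
  rewrite INR_IZR_INZ, Z2Nat.id by lia.
  split; [reflexivity | split; [lia|]]; intros t Ht.
  rewrite Z2Nat.id by lia; apply emb_inj.
  rewrite <- !(traj_IZR H D), plus_IZR; apply Hrec; now apply IZR_le.
Qed.

Lemma least_site_period (H : Z -> Z * Z) (p : nat) :
  site_period H p ->
  exists q, site_period H q /\ forall q', site_period H q' -> (q <= q')%nat.
Proof.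
  intros Hp.
  destruct (dec_inh_nat_subset_has_unique_least_element (site_period H))
    as (q & Hq & _); [intros; apply classic | now exists p | now exists q].
Qed.

Lemma site_period_mod (H : Z -> Z * Z) (p t : nat) :
  site_period H p -> H (Z.of_nat t) = H (Z.of_nat (t mod p)).
Proof.
  intros [Hp HP]; rewrite (Nat.div_mod_eq t p) at 1.
  generalize (t mod p)%nat; intros r; induction (t / p)%nat as [|k IH].
  - do 2 f_equal; lia.
  - rewrite <- IH, <- (HP (Z.of_nat (p * k + r))) by lia; f_equal; lia.
Qed.

(** The distinct visited sites in [K] bound the size from below, and the size bounds the least
    period, since one site is met per unit of time. *)
Lemma traj_period_size (H D : Z -> Z * Z) (p : nat) (K : list (Z * Z)) :
  (forall t, H (t + 1)%Z = padd (H t) (D t)) ->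
  (forall t, unit_direction (D t)) ->
  site_period H p ->
  NoDup K -> (forall h, In h K -> exists t : nat, H (Z.of_nat t) = h) ->
  exists (n : nat) (tau : R),
    has_size (traj H D 0) n /\ is_period (traj H D 0) tau /\
    (length K <= n)%nat /\ INR (length K) <= tau.
Proof.
  intros HH HU Hp HK Hin.
  destruct (least_site_period H p Hp) as (q & Hq & Hleast).
  set (l := nodup Zpair_eq_dec (map (fun t => H (Z.of_nat t)) (seq 0 q))).
  assert (Hl : forall h, In h l <-> exists t, (t < q)%nat /\ H (Z.of_nat t) = h).
  { intros h; unfold l; rewrite nodup_In, in_map_iff.
    split; intros (t & A & B); exists t; rewrite in_seq in *; split;
      (assumption || lia). }
  assert (Pq : is_period (traj H D 0) (INR q)).
  { split; [now apply recurs_after_site_period|].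
    intros tau Htau.
    destruct (site_period_recurs_after H D tau HU Htau) as (q' & -> & Hq').
    now apply le_INR, Hleast. }
  assert (Kl : (length K <= length l)%nat).
  { apply NoDup_incl_length; [exact HK|]; intros h Hh; apply Hl.
    destruct (Hin h Hh) as [t <-]; exists (t mod q)%nat; split.
    - apply Nat.mod_upper_bound; destruct Hq; lia.
    - symmetry; now apply site_period_mod. }
  assert (lq : (length l <= q)%nat).
  { rewrite <- (length_seq q 0), <- (length_map (fun t => H (Z.of_nat t))).
    apply NoDup_incl_length; [apply NoDup_nodup|].
    intros h; apply nodup_In. }
  exists (length l), (INR q).
  split; [|split; [exact Pq | split; [exact Kl | apply le_INR; lia]]].
  exists (INR q); split; [exact Pq|]; exists (map emb l).
  split; [|split; [apply length_map|]].
  - apply FinFun.Injective_map_NoDup; [exact emb_inj | apply NoDup_nodup].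
  - intros h; rewrite in_map_iff; split.
    + intros (x & <- & Hx); apply Hl in Hx as (t & Ht & <-).
      split; [apply site_iff_emb; eauto|]; exists (INR t); split.
      * split; [apply pos_INR | now apply lt_INR].
      * rewrite INR_IZR_INZ; apply traj_IZR.
    + intros (Hs & s & Hsq & <-).
      destruct (traj_site_integral H D s HU Hs) as [z ->].
      rewrite traj_IZR; exists (H z); split; [reflexivity|]; apply Hl.
      rewrite INR_IZR_INZ in Hsq; destruct Hsq as [Z0 Zq].
      apply le_IZR in Z0; apply lt_IZR in Zq.
      exists (Z.to_nat z); rewrite Z2Nat.id by lia; split; [lia | reflexivity].
Qed.

(** * Trajectories of arbitrarily large size and period *)

Lemma NoDup_times (k : nat) : NoDup (map times (seq 0 k)).
Proof.
  apply FinFun.Injective_map_NoDup; [|apply seq_NoDup].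
  intros i j E; unfold times in E; simpl in E; injection E; lia.
Qed.

Lemma large_trajectory (N : nat) (M : R) :
  (2 <= N)%nat ->
  exists (dt : nat -> R) (I : initial_data)
         (r v : nat -> R -> vec) (C : R -> vec -> Z),
    displacements N dt /\ initial_condition N dt I /\
    evolution N dt I r v C /\
    exists (i n : nat) (tau : R),
      (1 <= i <= N)%nat /\ periodic (r i) /\
      has_size (r i) n /\ is_period (r i) tau /\
      M <= INR n /\ M <= tau.
Proof.
  intros HN.
  (* The sites [times j] with [j < k] will be more than [M] distinct visited sites. *)
  destruct (INR_unbounded M) as [k Hk].
  destruct (large_periodic_orbit k) as (s0 & n & Hsig & Hunit & Hper & Hn & Hlong).
  destruct (orbit_bounded s0 n Hn) as [b Hb].
  assert (HO : periodic_pair s0 n b) by now constructor.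
  set (H := sites_of s0 n b); set (D := headings_of s0 n).
  set (c0 := full_config s0 b).
  assert (HH : forall i t, H i (t + 1)%Z = padd (H i t) (D i t))
    by (intros; now apply sites_of_next).
  assert (HU : forall i t, unit_direction (D i t))
    by (intros; now apply (headings_of_unit s0 n b)).
  assert (Hc : signs c0) by now apply (full_config_signs s0 n b).
  exists (dtN N), (start N H D c0), (fun i => traj (H i) (D i) (dtN N i)),
    (fun i => velo (D i) (dtN N i)), (confR N H c0).
  split; [apply displacements_dtN; lia|].
  split; [now apply start_initial_condition|].
  split.
  { apply lattice_evolution; [lia | exact Hc | now intros |].
    intros t j Hj; now apply headings_of_turn. }
  destruct (displacements_dtN N ltac:(lia)) as [D1 _ _].
  (* Particle 1 has displacement 0, and [n] units of time are the [n + n] half steps of the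
     orbit. *)
  destruct (traj_period_size (H 1%nat) (D 1%nat) n (map times (seq 0 k)))
    as (l & tau & Hl & Htau & Kl & Ktau); auto using NoDup_times.
  - split; [exact Hn|]; intros t _; unfold H, sites_of, first_of.
    rewrite <- (orbit_shift s0 n (2 * t) Hn); do 3 f_equal; lia.
  - intros h Hh; apply in_map_iff in Hh as (j & <- & Hj); apply in_seq in Hj.
    destruct (Hlong j ltac:(lia)) as [t Ht]; exists t.
    unfold H, sites_of, first_of; rewrite <- Ht, <- (orbit_iter s0 n) by assumption.
    do 3 f_equal; lia.
  - rewrite length_map, length_seq in Kl, Ktau; apply le_INR in Kl.
    exists 1%nat, l, tau; rewrite D1.
    split; [lia|]; split; [exists tau; apply Htau|].
    repeat split; try apply Hl; try apply Htau; lra.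
Qed.

Theorem theorem2 :
  (forall N : nat, (2 <= N)%nat ->
     exists (dt : nat -> R) (I : initial_data)
            (r v : nat -> R -> vec) (C : R -> vec -> Z),
       displacements N dt /\ initial_condition N dt I /\
       evolution N dt I r v C /\
       exists i : nat, (1 <= i <= N)%nat /\ periodic (r i))
  /\
  (forall (N : nat) (M : R), (2 <= N)%nat -> 0 < M ->
     exists (dt : nat -> R) (I : initial_data)
            (r v : nat -> R -> vec) (C : R -> vec -> Z),
       displacements N dt /\ initial_condition N dt I /\
       evolution N dt I r v C /\
       exists (i n : nat) (tau : R),
         (1 <= i <= N)%nat /\ periodic (r i) /\
         has_size (r i) n /\ is_period (r i) tau /\
         M <= INR n /\ M <= tau).
Proof.
  split.
  - intros N HN.
    destruct (large_trajectory N 1 HN)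
      as (dt & I & r & v & C & Hd & Hi & He & i & _ & _ & Hr & Hp & _).
    exists dt, I, r, v, C; eauto 8.
  - intros N M HN _; now apply large_trajectory.
Qed.
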